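(* Let $T_0$ be an orientation preserving diffeomorphism of the circle $\mathbb{S}^1$ with an irrational rotation number $\alpha$ and such that $\log(T_0')$ has bounded variation (for example, $T_0$ is of class $C^2$). Let $\mu_0$ be its unique invariant (absolutely continuous) probability measure. Let $\{T_\delta\}_{0\le\delta\le\overline{\delta}}$ be a family of Borel measurable maps of the circle such that $$\sup_{x\in\mathbb{S}^1}|T_0(x)-T_\delta(x)|\le\delta .$$ Suppose that for each $0\le\delta\le\overline{\delta}$, $\mu_\delta$ is an invariant Borel probability measure of $T_\delta$. Then $$\lim_{\delta\to0}\int_{\mathbb{S}^1}f\,d\mu_\delta=\int_{\mathbb{S}^1}f\,d\mu_0\qquad\text{for all }f\in C^0(\mathbb{S}^1).$$
   Context: $\mathbb{S}^1=\mathbb{R}/\mathbb{Z}$, $\overline{\delta}>0$, and $|x-y|$ denotes the circle distance between $x,y\in\mathbb{S}^1$. A measure $\mu$ is invariant for a Borel map $T$ if $\mu(T^{-1}(A))=\mu(A)$ for all Borel sets $A$. Absolute continuity is with respect to Lebesgue measure on $\mathbb{S}^1$. *)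

(* Defs.v *)
From HB Require Import structures.
From mathcomp Require Import all_boot all_order all_algebra ring_quotient.
From mathcomp Require Import generic_quotient.
From mathcomp Require Import all_classical all_reals all_analysis.

Set Implicit Arguments.
Unset Strict Implicit.
Unset Printing Implicit Defensive.

Import Order.TTheory GRing.Theory Num.Theory.
Import numFieldNormedType.Exports.

Local Open Scope classical_set_scope.
Local Open Scope ring_scope.
Local Open Scope quotient_scope.

(** The additive subgroup Z of R; [Num.int] is by definition the qualifier of
    [Num.int_num_subdef]. *)
Definition int_subgroup (R : realType) : zmodClosed R :=
  GRing.ZmodClosed.clone R (@Num.int_num_subdef R) _.

(** R/Z, with the quotient topology and its Borel sigma-algebra. *)
Definition circle (R : realType) : Type :=
  quotient_topology (Quotient.quot (int_subgroup R)).

Section circle_structures.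
Context {R : realType}.

HB.instance Definition _ := Quotient.on (circle R).
HB.instance Definition _ := Pointed.on (circle R).
HB.instance Definition _ := Topological.on (circle R).

Let borel := g_sigma_algebraType (@open (circle R)).
HB.instance Definition _ :=
  @isMeasurable.Build (sigma_display (@open (circle R))) (circle R)
    (@measurable _ borel) (@measurable0 _ borel) (@measurableC _ borel)
    (@bigcupT_measurable _ borel).

End circle_structures.

Definition circle_proj {R : realType} (t : R) : circle R := \pi_(circle R) t.

Section circle_maps.
Context {R : realType}.
Implicit Types (T : circle R -> circle R) (F : R -> R).

Definition circle_dist (x y : circle R) : R :=
  inf [set `|a - b| | a in circle_proj @^-1` [set x] &
                      b in circle_proj @^-1` [set y]].

Definition is_lift T F : Prop :=
  continuous F /\ forall t, circle_proj (F t) = T (circle_proj t).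

Definition C1_map T : Prop :=
  exists F,
    [/\ is_lift T F, forall t, derivable F t 1 & continuous (derive1 F)].

Definition diffeomorphism T : Prop :=
  C1_map T /\ exists S, [/\ C1_map S, cancel T S & cancel S T].

Definition orientation_preserving T : Prop :=
  exists2 F, is_lift T F & {homo F : s t / s < t}.

(** The rotation number is an element of R/Z; [alpha] is one of its real
    representatives.  All of them are irrational as soon as one is. *)
Definition rotation_number T (alpha : R) : Prop :=
  exists2 F, is_lift T F &
    forall t, (iter n F t / n%:R) @[n --> \oo] --> alpha.

(** Two lifts of the same map differ by an integer constant, so the derivative
    depends neither on the chosen lift nor on the representative of [x]. *)
Definition circle_deriv T (x : circle R) : R :=
  derive1 (get (is_lift T : set (R -> R))) (repr x).

(** The total variation over the circle is the one over a fundamental domain. *)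
Definition circle_BV (g : circle R -> R) : Prop :=
  bounded_variation 0 1 (g \o circle_proj).

Definition invariant_measure
    (mu : {measure set (circle R) -> \bar R}) T : Prop :=
  forall A, measurable A -> mu (T @^-1` A) = mu A.

End circle_maps.

(* Main.v *)
(** The key fact is that the averages of [f] along the orbits of [T 0] are
    uniformly nearly constant.  Let [F] be a lift of [T 0]; its orbits modulo Z
    are ordered like those of the rotation by [alpha].  Given [L], let [q] be
    the closest return time of the rotation up to time [L].  For every [v], the
    first [L] iterates of the arc from [v] to [F^q v] are pairwise disjoint, so
    their lengths add up to at most 1 and the [L]-averages of [f] at two points
    of such an arc are close.  Consecutive arcs [F^(nq) u, F^((n+1)q) u] cover
    the circle for boundedly many [n], and shifting an orbit by a bounded time
    does not affect its long averages.  Such an average is a finite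
    combination of the [f \o T 0 ^ k], hence is uniformly close to the
    corresponding one for [T delta] with [delta] small, whose integral against
    [mu delta] is that of [f] by invariance. *)
Require Import Defs.
From HB Require Import structures.
From mathcomp Require Import all_boot all_order all_algebra.
From mathcomp Require Import all_classical all_reals all_analysis measurable_realfun.
From mathcomp Require Import lra ring.

Import Order.TTheory GRing.Theory Num.Theory.
Import numFieldNormedType.Exports.

Local Open Scope classical_set_scope.
Local Open Scope ring_scope.

(** * Maps of degree one, and elementary facts on reals and finite sums *)

Section degree_one_maps.
Context {R : realType} (F : R -> R).
Hypothesis F_deg1 : forall t, F (t + 1) = F t + 1.

Lemma deg1D_int t (m : int) : F (t + m%:~R) = F t + m%:~R.
Proof.
have nat_case s n : F (s + n%:R) = F s + n%:R.
  elim: n => [|n IHn]; first by rewrite !addr0.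
  by rewrite -natr1 addrA F_deg1 IHn addrA.
case: m => n; first exact: nat_case.
rewrite NegzE mulrNz -pmulrn.
by rewrite -[in RHS](subrK n.+1%:R t) nat_case addrK.
Qed.

Lemma iter_deg1 n t : iter n F (t + 1) = iter n F t + 1.
Proof. by elim: n => //= n ->; rewrite F_deg1. Qed.

End degree_one_maps.

(** Compare Lebesgue measures. Segments may share an endpoint, hence the half-open intervals [[l k,
    r k[], which are truly disjoint. *)
Lemma sum_disjoint_segments {R : realType} (a b : R) (n : nat) (l r : nat -> R) :
  a <= b ->
  (forall k, (k < n)%N -> [/\ a <= l k, l k <= r k & r k <= b]) ->
  (forall j k, (j < n)%N -> (k < n)%N -> j != k -> r j <= l k \/ r k <= l j) ->
  \sum_(k < n) (r k - l k) <= b - a.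
Proof.
move=> ab lr_ab disj.
pose I (k : nat) : set R := [set` `[l k, r k[].
have tI : trivIset [set: 'I_n] (fun k : 'I_n => I k).
  apply/trivIsetP => j k _ _ jk; apply/seteqP; split=> // x [].
  rewrite /I /= !in_itv /= => /andP[lj rj] /andP[lk rk].
  by case: (disj j k (ltn_ord j) (ltn_ord k) jk) => h; lra.
have mI (k : 'I_n) : measurable (I k : set (measurableTypeR R)) by exact: measurable_itv.
have lI (k : 'I_n) : (lebesgue_measure (I k) = (r k - l k)%:E)%E.
  have [_ lrk _] := lr_ab k (ltn_ord k).
  rewrite lebesgue_measure_itv /= lte_fin EFinB.
  by case: ltgtP lrk => // -> _; rewrite subee.
have : (lebesgue_measure (\big[setU/set0]_(k < n) I k) <=
        lebesgue_measure [set` `[a, b]] :> \bar R)%E.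
  apply: le_measure; rewrite ?inE.
  - by apply: (bigsetU_measurable (T := measurableTypeR R)) => k _; exact: mI.
  - exact: measurable_itv.
  apply: (big_ind (fun A => A `<=` _)) => [//|A B ? ?|k _ x]; first by rewrite subUset.
  rewrite /I /= !in_itv /=.
  by have [? ? ?] := lr_ab k (ltn_ord k) => /andP[? ?]; apply/andP; split; lra.
rewrite (@measure_bigsetU_ord _ _ (measurableTypeR R) lebesgue_measure n xpredT (fun k : 'I_n => I k) mI tI).
rewrite (eq_bigr (fun k : 'I_n => (r k - l k)%:E)); last by move=> k _; exact: lI.
rewrite lebesgue_measure_itv /= lte_fin.
case: ltgtP ab => // [_ _|<- _]; rewrite ?subrr sumEFin -?EFinB lee_fin //.
Qed.

(** The minimizer is [- floor x] or [- floor x - 1], according to which end of its unit interval [x]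
    is nearer to. *)
Lemma nearest_int {R : realType} (x : R) :
  exists p : int, forall j : int, `|x + p%:~R| <= `|x + j%:~R|.
Proof.
have /andP[] := floor_itv x; set f := Num.floor x; rewrite intrD mulr1z => fx xf.
have far (p j : int) : j != p ->
    j%:~R + 1 <= p%:~R :> R \/ p%:~R + 1 <= j%:~R :> R.
  rewrite neq_lt => /orP[] jp; [left|right];
    by rewrite -[1]/(1%:~R) -intrD ler_int lezD1.
have [h|h] := leP (x - f%:~R) (1 / 2).
- exists (- f) => j; have [->//|/far] := eqVneq j (- f).
  rewrite mulrNz => -[] ?; by case: (ger0P (x + j%:~R)) => ?; case: ger0P => ?; lra.
- exists (- f - 1) => j; have [->//|/far] := eqVneq j (- f - 1).
  rewrite intrB mulrNz mulr1z => -[] ?;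
  by case: (ger0P (x + j%:~R)) => ?; case: ger0P => ?; lra.
Qed.

Lemma discrete_IVT {R : realType} (z : nat -> R) M s : z 0%N <= s <= z M.+1 ->
  exists2 n, (n <= M)%N & z n <= s <= z n.+1.
Proof.
elim: M => [|M IHM] /andP[z0 zM]; first by exists 0%N => //; rewrite z0.
have [szM|zMs] := leP s (z M.+1); last by exists M.+1 => //; rewrite zM ltW.
by case: IHM => [|n nM zn]; [rewrite z0|exists n => //; rewrite (leq_trans nM)].
Qed.

Lemma periodic_int {R : realType} (phi : R -> R) :
  (forall t, phi (t + 1) = phi t) -> forall t (m : int), phi (t + m%:~R) = phi t.
Proof.
(* Adding the identity to a periodic function yields a map of degree one. *)
move=> per t m; have deg1 s : phi (s + 1) + (s + 1) = phi s + s + 1.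
  by rewrite per addrA.
by have := deg1D_int (fun s => phi s + s) deg1 t m; lra.
Qed.

(** Each unit shift drops one term and gains another, at a cost of at most [B]. The bound is
    independent of [N], so averages over long windows hardly move. *)
Lemma dist_sum_shift {R : realType} (g : nat -> R) (B : R) N m :
  (forall i j, `|g i - g j| <= B) ->
  `|\sum_(k < N) g k - \sum_(k < N) g (m + k)%N| <= m%:R * B.
Proof.
move=> gB; elim: m => [|m IHm]; first by rewrite subrr normr0 mul0r.
have -> : \sum_(k < N) g (m.+1 + k)%N =
          \sum_(k < N) g (m + k)%N + (g (m + N)%N - g m).
  (* The same sum of [N + 1] terms is split at its first and at its last term. *)
  have := erefl (\sum_(k < N.+1) g (m + k)%N).
  rewrite {1}big_ord_recl big_ord_recr /= addn0.
  under [X in _ + X = _]eq_bigr do rewrite /bump leq0n addnCA addnA add1n.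
  by move=> ?; lra.
have := gB (m + N)%N m; rewrite -natr1 mulrDl mul1r.
set s1 := \sum_(k < N) g k in IHm *; set s2 := \sum_(k < N) _ in IHm *.
rewrite !ler_norml in IHm *; move=> /andP[? ?]; move: IHm => /andP[? ?].
by apply/andP; split; lra.
Qed.

(** * Orbits modulo Z are ordered as for the rotation; closest returns and uniform averages *)

Section orbit_order.
Context {R : realType} (F : R -> R) (alpha : R).
Hypothesis F_incr : {homo F : s t / s < t}.
Hypothesis F_deg1 : forall t, F (t + 1) = F t + 1.
Hypothesis F_rot : forall t, (iter n F t / n%:R) @[n --> \oo] --> alpha.

Lemma iter_incr n : {homo iter n F : s t / s < t}.
Proof. by elim: n => // n IHn s t st /=; exact/F_incr/IHn. Qed.

Lemma iter_nondecr n : {homo iter n F : s t / s <= t}.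
Proof.
by move=> s t; rewrite le_eqVlt => /predU1P[->//|/(@iter_incr n)/ltW].
Qed.

Lemma iterD_int n t (m : int) : iter n F (t + m%:~R) = iter n F t + m%:~R.
Proof. by apply: deg1D_int => s; exact: iter_deg1. Qed.

Lemma iter_translate k i (m : int) t :
  iter k (fun s => iter i F s + m%:~R) t = iter (k * i) F t + (m * k)%:~R.
Proof.
elim: k => [|k IHk] /=; first by rewrite mulr0 addr0.
rewrite IHk iterD_int mulSn iterD -addrA -intrD; congr (_ + _%:~R).
by rewrite -addn1 PoszD mulrDr mulr1.
Qed.

(** The map [F^i + m] has rotation number [i * alpha + m]: read the limit defining [alpha] along the
    subsequence [k * i]. *)
Lemma cvg_iter_translate i (m : int) t : (0 < i)%N ->
  ((iter k (fun s => iter i F s + m%:~R) t) / k%:R) @[k --> \oo] -->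
  i%:R * alpha + m%:~R.
Proof.
move=> i0; have i0' : i%:R != 0 :> R by rewrite pnatr_eq0 -lt0n.
have sub : (iter (k * i) F t / (k * i)%:R) @[k --> \oo] --> alpha.
  apply: cvg_comp (F_rot t).
  move=> A [N _ NA]; exists N => // k /= Nk; apply: NA => /=.
  by rewrite (leq_trans Nk)// leq_pmulr.
have : (i%:R * (iter (k * i) F t / (k * i)%:R) + m%:~R) @[k --> \oo] -->
    i%:R * alpha + m%:~R.
  by apply: cvgD; [exact: cvgMr|exact: cvg_cst].
apply: cvg_trans; apply: near_eq_cvg; near=> k.
have k0 : k%:R != 0 :> R by rewrite pnatr_eq0 -lt0n; near: k; exact: nbhs_infty_gt.
rewrite iter_translate natrM intrM mulrDl -pmulrn mulfK//.
by field; apply/andP.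
Unshelve. all: by end_near. Qed.

Lemma cvg_cst_div_nat (t : R) : (t / k%:R) @[k --> \oo] --> (0 : R).
Proof.
rewrite -cvg_shiftS.
suff : (t * harmonic k) @[k --> \oo] --> t * 0 by rewrite mulr0.
by apply: cvgMr; exact: cvg_harmonic.
Qed.

(** If the nondecreasing map [F^i + m] does not move [t] to the right, neither do its iterates;
    divide by [k] and let [k] tend to infinity. *)
Lemma rotation_le i (m : int) t :
  iter i F t + m%:~R <= t -> i%:R * alpha + m%:~R <= 0.
Proof.
case: (posnP i) => [->/=|i0 le_t]; first by rewrite mul0r add0r => h; lra.
apply: ler_cvg_to (cvg_iter_translate i m t i0) (cvg_cst_div_nat t) _.
near=> k; rewrite ler_wpM2r// ?invr_ge0//.
elim: (k) => //= n IHn; apply: le_trans le_t.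
by rewrite lerD2r; exact: iter_nondecr.
Unshelve. all: by end_near. Qed.

Lemma rotation_ge i (m : int) t :
  t <= iter i F t + m%:~R -> 0 <= i%:R * alpha + m%:~R.
Proof.
case: (posnP i) => [->/=|i0 ge_t]; first by rewrite mul0r add0r => h; lra.
apply: ler_cvg_to (cvg_cst_div_nat t) (cvg_iter_translate i m t i0) _.
near=> k; rewrite ler_wpM2r// ?invr_ge0//.
elim: (k) => //= n IHn; apply: le_trans ge_t _.
by rewrite lerD2r; exact: iter_nondecr.
Unshelve. all: by end_near. Qed.

(** By contraposition: start from the earlier of the two orbit points, so that the opposite order
    becomes a statement on one map [F^|i - j|] plus an integer, whose rotation number then has the
    wrong sign. *)
Lemma orbit_lt i j (m n : int) t :
  i%:R * alpha + m%:~R < j%:R * alpha + n%:~R ->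
  iter i F t + m%:~R < iter j F t + n%:~R.
Proof.
move=> lt_ij; rewrite ltNge; apply/negP => le_ji.
have [/subnK ij|/ltnW/subnK ji] := leqP i j.
- have /rotation_le : iter (j - i) F (iter i F t) + (n - m)%:~R <= iter i F t.
    by rewrite -iterD ij intrB; lra.
  by rewrite intrB natrB; [lra|rewrite -ij leq_addl].
- have /rotation_ge : iter j F t <= iter (i - j) F (iter j F t) + (m - n)%:~R.
    by rewrite -iterD ji intrB; lra.
  by rewrite intrB natrB; [lra|rewrite -ji leq_addl].
Qed.

Hypothesis alpha_irr : irrational alpha.

Lemma rotation_neq0 i (m : int) : (0 < i)%N -> i%:R * alpha + m%:~R != 0.
Proof.
move=> i0; apply/eqP => eq0; apply: alpha_irr; apply/rationalP.
exists (- m), i; rewrite mulrNz; apply: (mulIf (x := i%:R)).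
  by rewrite pnatr_eq0 -lt0n.
by rewrite divfK ?pnatr_eq0 -?lt0n//; lra.
Qed.

(** By irrationality, equal coordinates force [i = j] and equal integer parts, so the two points
    coincide. *)
Lemma orbit_le i j (m n : int) t :
  i%:R * alpha + m%:~R <= j%:R * alpha + n%:~R ->
  iter i F t + m%:~R <= iter j F t + n%:~R.
Proof.
rewrite le_eqVlt => /predU1P[eq_ij|/orbit_lt/ltW//].
have [lt_ij|lt_ji|ij] := ltngtP i j.
- have := rotation_neq0 (j - i) (n - m); rewrite subn_gt0 => /(_ lt_ij).
  by rewrite intrB natrB 1?ltnW// => /eqP; lra.
- have := rotation_neq0 (i - j) (m - n); rewrite subn_gt0 => /(_ lt_ji).
  by rewrite intrB natrB 1?ltnW// => /eqP; lra.
- by move: eq_ij; rewrite ij => /addrI ->.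
Qed.

(** In rotation coordinates the arcs become segments of length [|beta|] with starting points at
    least [|beta|] apart, by minimality of [beta]. They fit disjointly in one period, and [orbit_le]
    carries this order back to the orbits of [F]. *)
Lemma closest_return_arcs (L q : nat) (p : int) v : (0 < L)%N ->
  (forall k (j : int), (0 < k <= L)%N ->
     `|q%:R * alpha + p%:~R| <= `|k%:R * alpha + j%:~R|) ->
  \sum_(k < L) `|iter k F (iter q F v + p%:~R) - iter k F v| <= 1.
Proof.
move=> L0; set beta := _ + _ => beta_min.
(* [c k] is the fractional part of [k * alpha], and [j k] the translation that realizes it. *)
pose j k : int := - Num.floor (k%:R * alpha).
pose c k : R := k%:R * alpha + (j k)%:~R.
have c_itv k : 0 <= c k < 1.
  have := floor_itv (k%:R * alpha); rewrite /c /j mulrNz intrD.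
  by move=> /andP[? ?]; apply/andP; split; lra.
have beta1 : `|beta| <= 1.
  have := c_itv 1%N; have := beta_min 1%N (j 1%N) L0.
  by rewrite -/(c 1%N) => h /andP[c0 c1]; rewrite (ger0_norm c0) in h; lra.
(* For [k > 0], minimality is tested against the integer above [k * alpha]; for [k = 0] the claim is
   [|beta| <= 1]. *)
have c_le k : (k < L)%N -> c k <= 1 - `|beta|.
  case: k => [_|k kL]; first by rewrite /c /j mul0r floor0 oppr0 addr0; lra.
  have := beta_min k.+1 (j k.+1 - 1) (ltnW kL).
  have := c_itv k.+1; rewrite intrB mulr1z addrA -/(c k.+1) => /andP[_ c1].
  by rewrite (ltr0_norm (x := c k.+1 - 1)) ?subr_lt0//; lra.
have c_sep_lt i k : (i < k)%N -> (k < L)%N -> `|beta| <= `|c i - c k|.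
  move=> ik kL; rewrite distrC.
  have -> : c k - c i = (k - i)%:R * alpha + (j k - j i)%:~R.
    by rewrite /c natrB 1?ltnW// intrB; ring.
  by apply: beta_min; rewrite subn_gt0 ik (leq_trans (leq_subr _ _))// ltnW.
have c_sep i k : (i < L)%N -> (k < L)%N -> i != k -> `|beta| <= `|c i - c k|.
  move=> iL kL; rewrite neq_ltn => /orP[ik|ki]; first exact: c_sep_lt.
  by rewrite distrC; exact: c_sep_lt.
have c_sep2 i k : (i < L)%N -> (k < L)%N -> i != k ->
    c i + `|beta| <= c k \/ c k + `|beta| <= c i.
  move=> iL kL ik; have := c_sep i k iL kL ik.
  by case: (lerP (c i) (c k)) => h ?; [left|right]; lra.
pose P i (m : int) := iter i F v + m%:~R.
have P_shift k : iter k F (iter q F v + p%:~R) = P (k + q)%N p.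
  by rewrite iterD_int -iterD.
have coord k (m : int) : (k + q)%:R * alpha + (p + m)%:~R = k%:R * alpha + m%:~R + beta.
  by rewrite /beta natrD intrD; ring.
(* The arcs point right or left with the sign of [beta]. They lie in the period starting at [v] in
   the first case, at [iter q F v + p] in the second. *)
have [beta0|beta0] := leP 0 beta.
- rewrite ger0_norm// in beta1 c_le c_sep2.
  suff : \sum_(k < L) `|iter k F (iter q F v + p%:~R) - iter k F v| <=
         P 0%N 1 - P 0%N 0 by rewrite /P/=; lra.
  have lr k : P k (j k) <= P (k + q)%N (p + j k).
    by apply: orbit_le; rewrite coord; lra.
  rewrite (eq_bigr (fun k : 'I_L => P (k + q)%N (p + j k) - P k (j k))); last first.
    move=> k _ /=; have := lr k; rewrite P_shift /P intrD => h.
    by rewrite ger0_norm; lra.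
  apply: (sum_disjoint_segments _ _ L (fun k => P k (j k))
            (fun k => P (k + q)%N (p + j k))).
  + by rewrite /P/=; lra.
  + move=> k kL; have /andP[c0 _] := c_itv k; have := c_le k kL.
    by split=> //; apply: orbit_le; rewrite ?coord -?/(c k); lra.
  + move=> i k iL kL ik.
    by case: (c_sep2 i k iL kL ik) => h; [left|right];
      apply: orbit_le; rewrite ?coord -?/(c k) -?/(c i); lra.
- rewrite ltr0_norm// in beta1 c_le c_sep2.
  suff : \sum_(k < L) `|iter k F (iter q F v + p%:~R) - iter k F v| <=
         P q (p + 1) - P q p by rewrite /P intrD; lra.
  have lr k : P (k + q)%N (p + j k) <= P k (j k).
    by apply: orbit_le; rewrite coord; lra.
  rewrite (eq_bigr (fun k : 'I_L => P k (j k) - P (k + q)%N (p + j k))); last first.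
    move=> k _ /=; have := lr k; rewrite P_shift /P intrD => h.
    by rewrite ler0_norm; lra.
  have qE : q%:R * alpha = beta - p%:~R by rewrite /beta; lra.
  apply: (sum_disjoint_segments _ _ L (fun k => P (k + q)%N (p + j k))
            (fun k => P k (j k))).
  + by rewrite /P/= intrD; lra.
  + move=> k kL; have /andP[c0 _] := c_itv k; have := c_le k kL.
    by split=> //; apply: orbit_le; rewrite ?coord -?/(c k) ?intrD qE; lra.
  + move=> i k iL kL ik.
    by case: (c_sep2 i k iL kL ik) => h; [left|right];
      apply: orbit_le; rewrite ?coord -?/(c k) -?/(c i); lra.
Qed.

(** Induction on [L]: keep the previous return, or take time [L + 1] with its nearest integer if
    that is closer. At [L = 0] the range of [k] is empty. *)
Lemma closest_return L : exists q (p : int), (0 < q)%N /\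
  forall k (j : int), (0 < k <= L)%N ->
    `|q%:R * alpha + p%:~R| <= `|k%:R * alpha + j%:~R|.
Proof.
elim: L => [|L [q [p [q0 qp]]]]; first by exists 1%N, 0; split=> // -[|k].
have [r near_r] := nearest_int (L.+1%:R * alpha).
have [le_qL|lt_Lq] :=
  leP `|q%:R * alpha + p%:~R| `|L.+1%:R * alpha + r%:~R|.
- exists q, p; split=> // k j /andP[k0]; rewrite leq_eqVlt => /predU1P[->|kL].
    exact: le_trans le_qL _.
  by apply: qp; rewrite k0.
- exists L.+1, r; split=> // k j /andP[k0]; rewrite leq_eqVlt.
  move=> /predU1P[->//|kL]; apply: le_trans (ltW lt_Lq) _.
  by apply: qp; rewrite k0.
Qed.

(** The chain advances by the nonzero [beta] in rotation coordinates, so it runs through a whole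
    period once [(M + 1) * |beta| > 1]; this [M] is uniform in [u] and [t]. *)
Lemma orbit_chain q (p : int) : (0 < q)%N -> exists M, forall u t,
  let z n := iter n (fun s => iter q F s + p%:~R) u in
  exists n (j : int), (n <= M)%N /\
    (z n <= t + j%:~R <= z n.+1 \/ z n.+1 <= t + j%:~R <= z n).
Proof.
move=> q0; have := rotation_neq0 q p q0; set beta := _ + _ => beta_neq0.
pose M := Num.trunc (`|beta|^-1); exists M => u t z.
have Mbeta : 1 < M.+1%:R * `|beta|.
  by rewrite -ltr_pdivrMr ?normr_gt0// div1r truncnS_gt.
have zM : z M.+1 = iter (M.+1 * q) F u + (p * M.+1)%:~R.
  by rewrite /z iter_translate.
have coord : (M.+1 * q)%:R * alpha + (p * M.+1)%:~R = M.+1%:R * beta.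
  by rewrite /beta natrM intrM -pmulrn; ring.
have fl := floor_itv (t - u); rewrite intrD mulr1z in fl.
have z0 : z 0%N = u by [].
case: (ltgtP beta 0) beta_neq0 => // beta0 _.
- rewrite (ltr0_norm beta0) in Mbeta.
  have zMu : z M.+1 < u - 1.
    rewrite zM -[u - 1]/(iter 0 F u + (-1)%:~R); apply: orbit_lt.
    by rewrite coord mul0r; lra.
  (* The chain moves left: the extra [- 1] places the translate of [t] in [[u - 1, u)], and the sign
     change reverses the order. *)
  have [|n nM zn] := discrete_IVT (fun n => - z n) M
      (- (t + (- Num.floor (t - u) - 1)%:~R)).
    by rewrite intrB mulrNz mulr1z z0; lra.
  by exists n, (- Num.floor (t - u) - 1); split => //; right; lra.
- rewrite (gtr0_norm beta0) in Mbeta.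
  have zMu : u + 1 < z M.+1.
    rewrite zM -[u + 1]/(iter 0 F u + 1%:~R); apply: orbit_lt.
    by rewrite coord mul0r; lra.
  have [|n nM zn] := discrete_IVT z M (t + (- Num.floor (t - u))%:~R).
    by rewrite mulrNz z0; lra.
  by exists n, (- Num.floor (t - u)); split => //; left.
Qed.

Lemma iter_between k a b s : a <= s <= b \/ b <= s <= a ->
  `|iter k F a - iter k F s| <= `|iter k F b - iter k F a|.
Proof.
by case=> /andP[/(iter_nondecr k) ? /(iter_nondecr k) ?];
  [rewrite ler0_norm ?ger0_norm|rewrite ger0_norm ?ler0_norm]; lra.
Qed.

(** Error budget per term: [eps / 3] from the modulus of [phi], [eps / 3] from the lengths of the
    arcs, [eps / 3] from the time shift. The list [s] encodes a double average, so its times occur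
    with multiplicity. *)
Lemma uniform_orbit_averages (phi : R -> R) (eps : R) :
  (forall t, phi (t + 1) = phi t) ->
  (forall e : R, 0 < e ->
     exists2 C : R, 0 <= C & forall a b, `|phi a - phi b| <= e + C * `|a - b|) ->
  0 < eps ->
  exists2 s : seq nat, (0 < size s)%N & forall u t,
    `|\sum_(k <- s) phi (iter k F u) - \sum_(k <- s) phi (iter k F t)|
      <= eps * (size s)%:R.
Proof.
move=> per modul eps0.
have per_int := periodic_int phi per.
have e0 : 0 < eps / 3 by lra.
have [C C0 phiC] := modul _ e0.
(* Bound on the oscillation of [phi]: by periodicity the two points can be brought within distance
   1. *)
pose B := eps / 3 + C.
have phiB a b : `|phi a - phi b| <= B.
  have /andP[] := floor_itv (a - b); rewrite intrD mulr1z => fl fu.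
  rewrite -(per_int b (Num.floor (a - b))).
  apply: le_trans (phiC _ _) _; rewrite lerD2l ler_piMr//.
  by rewrite ger0_norm; lra.
(* The arcs have total length at most 1, so they contribute at most [C], that is [eps / 3] per term
   of the window. *)
pose L := (Num.trunc (C / (eps / 3))).+1.
have CL : C <= L%:R * (eps / 3).
  by rewrite -ler_pdivrMr// ltW// truncnS_gt.
have [q [p [q0 qp]]] := closest_return L.
have [M chain] := orbit_chain q p q0.
pose N := (Num.trunc ((M * q)%:R * B / (eps / 3))).+1.
have BN : (M * q)%:R * B <= N%:R * (eps / 3).
  by rewrite -ler_pdivrMr// ltW// truncnS_gt.
pose g u := \sum_(l < L) phi (iter l F u).
have gB a b : `|g a - g b| <= L%:R * B.
  rewrite /g -sumrB; apply: le_trans (ler_norm_sum _ _ _) _.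
  rewrite -[L in L%:R]card_ord mulr_natl -sumr_const.
  by apply: ler_sum => l _; exact: phiB.
have g_int u (m : int) : g (u + m%:~R) = g u.
  by apply: eq_bigr => l _; rewrite iterD_int per_int.
have g_arc v t : let w := iter q F v + p%:~R in
    v <= t <= w \/ w <= t <= v -> `|g v - g t| <= L%:R * (eps / 3) * 2.
  move=> w vtw; rewrite /g -sumrB; apply: le_trans (ler_norm_sum _ _ _) _.
  have := closest_return_arcs L q p v isT qp; rewrite -/w => arcs.
  apply: le_trans (_ : _ <= \sum_(l < L)
      (eps / 3 + C * `|iter l F w - iter l F v|)) _.
    apply: ler_sum => l _; apply: le_trans (phiC _ _) _.
    by rewrite lerD2l ler_wpM2l//; exact: iter_between.
  rewrite big_split /= sumr_const card_ord -mulr_natl -mulr_sumr.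
  have := ler_wpM2l C0 arcs; lra.
(* Window [L] makes the averages close along each arc; the longer window [N]
   absorbs the time shift [n * q] needed to reach the arc containing [t]. *)
exists [seq (k + l)%N | k <- iota 0 N, l <- iota 0 L].
  by rewrite size_allpairs !size_iota.
move=> u t.
have sumE x : \sum_(k <- [seq (k + l)%N | k <- iota 0 N, l <- iota 0 L])
    phi (iter k F x) = \sum_(k < N) g (iter k F x).
  rewrite big_allpairs_dep -[iota 0 N]/(index_iota 0 N) big_mkord.
  apply: eq_bigr => k _; rewrite -[iota 0 L]/(index_iota 0 L) big_mkord.
  by apply: eq_bigr => l _; rewrite addnC iterD.
rewrite !sumE size_allpairs !size_iota.
have [n [j [nM zn]]] := chain u t.
set z := iter n _ u in zn.
have zE : z = iter (n * q) F u + (p * n)%:~R by rewrite /z iter_translate.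
have near_t : `|\sum_(k < N) g (iter (n * q + k) F u) -
                \sum_(k < N) g (iter k F t)| <= N%:R * (L%:R * (eps / 3) * 2).
  rewrite -sumrB; apply: le_trans (ler_norm_sum _ _ _) _.
  rewrite -[N in N%:R]card_ord mulr_natl -sumr_const.
  apply: ler_sum => k _.
  have -> : g (iter (n * q + k) F u) = g (iter k F z).
    by rewrite zE iterD_int g_int -iterD addnC.
  have -> : g (iter k F t) = g (iter k F (t + j%:~R)) by rewrite iterD_int g_int.
  (* [F^k] is monotone and commutes with the chain step, so it sends the arc containing [t + j] to
     an arc of the same kind. *)
  apply: g_arc; rewrite -iterD addnC iterD -iterD_int.
  by case: zn => /= /andP[? ?]; [left|right]; apply/andP; split; exact: iter_nondecr.
have near_u : `|\sum_(k < N) g (iter k F u) -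
                \sum_(k < N) g (iter (n * q + k) F u)| <= N%:R * L%:R * (eps / 3).
  apply: le_trans (dist_sum_shift (fun k => g (iter k F u)) _ N (n * q) _) _.
    by move=> *; exact: gB.
  apply: le_trans (_ : _ <= (M * q)%:R * (L%:R * B)) _.
    rewrite ler_wpM2r ?ler_nat ?leq_mul2r ?nM ?orbT// mulr_ge0// /B; lra.
  by have := ler_wpM2l (ler0n R L) BN; lra.
rewrite natrM; apply: le_trans (ler_distD (\sum_(k < N) g (iter (n * q + k) F u)) _ _) _.
lra.
Qed.

End orbit_order.

(** * Continuous functions on the line: periodic ones and integer-valued ones *)

Lemma periodic_reduce {R : realType} (x : R) :
  exists m : int, 0 <= x + m%:~R <= 1.
Proof.
exists (- Num.floor x); have := floor_itv x.
by rewrite intrD mulr1z mulrNz; lra.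
Qed.

Lemma periodic_bounded {R : realType} (phi : R -> R) :
  (forall t, phi (t + 1) = phi t) -> continuous phi ->
  exists2 B : R, 0 <= B & forall a, `|phi a| <= B.
Proof.
move=> per cphi.
have cont01 : {within `[0, 1], continuous phi} by exact: continuous_subspaceT.
have [c _ max_c] := EVT_max ler01 cont01.
have [d _ min_d] := EVT_min ler01 cont01.
exists (`|phi c| + `|phi d|) => // a.
have [m a01] := periodic_reduce a.
rewrite -(periodic_int phi per a m).
have := max_c (a + m%:~R); have := min_d (a + m%:~R); rewrite in_itv /= a01.
move=> /(_ isT) ? /(_ isT) ?.
have := ler_norm (phi c); have := ler_norm (- phi d).
by rewrite normrN ler_norml => ? ?; apply/andP; split;
  have := normr_ge0 (phi c); have := normr_ge0 (phi d); lra.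
Qed.

(* Uniform continuity in an additive form, which can be summed over arcs whose
   total length is bounded. *)
Lemma periodic_modulus {R : realType} (phi : R -> R) :
  (forall t, phi (t + 1) = phi t) -> continuous phi ->
  forall e : R, 0 < e ->
  exists2 C : R, 0 <= C & forall a b, `|phi a - phi b| <= e + C * `|a - b|.
Proof.
move=> per cphi e e0.
have [B B0 phiB] := periodic_bounded phi per cphi.
(* Only [a] is confined to [[0, 1]]; [b] is free, so nearby pairs across an endpoint are covered.
   Compactness makes [d] uniform. *)
have [d d0 dP] : exists2 d : R, 0 < d & forall a : R, a \in `[0, 1] ->
    forall b, `|a - b| < d -> `|phi a - phi b| <= e.
  have local (x : R) : \forall y \near x & d \near (0 : R)^'+,
      forall b, `|y - b| < d -> `|phi y - phi b| <= e.
    have /cvgrPdist_le/(_ (e / 2)) := cphi x.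
    case=> [|r /= r0 rP]; first by rewrite divr_gt0.
    have r20 : 0 < r / 2 by rewrite divr_gt0.
    near=> y d => b /= yb.
    have xy : `|x - y| < r / 2.
      by near: y; exists (r / 2).
    have dr : d < r / 2.
      by near: d; apply: nbhs_right_lt; lra.
    have h1 : `|phi x - phi y| <= e / 2 by apply: rP => /=; lra.
    have h2 : `|phi x - phi b| <= e / 2.
      by apply: rP => /=; have := ler_distD y x b; lra.
    by have := ler_distD (phi x) (phi y) (phi b); rewrite (distrC (phi y) (phi x)); lra.
  have := @segment_compact R 0 1 => /compact_near_coveringP.
  move=> /(_ R (0 : R)^'+
    (fun d a => forall b, `|a - b| < d -> `|phi a - phi b| <= e)).
  case.
  - by move=> x _; exact: local.
  - move=> r /= r0 rP; have r20 : 0 < r / 2 by rewrite divr_gt0.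
    exists (r / 2) => // a a01; apply: rP => //=.
    by rewrite sub0r normrN gtr0_norm//; lra.
(* Beyond distance [d], the linear term alone exceeds the trivial bound [2 * B]. *)
exists (B *+ 2 / d) => [|a b]; first by rewrite divr_ge0 ?mulrn_wge0 // ltW.
have [ab|ab] := ltP `|a - b| d.
- have [m a01] := periodic_reduce a.
  rewrite -(periodic_int phi per a m) -(periodic_int phi per b m).
  apply: le_trans (_ : e <= _).
    by apply: dP; rewrite ?in_itv // opprD addrACA subrr addr0.
  by rewrite lerDl mulr_ge0// divr_ge0 ?mulrn_wge0 // ltW.
- have := ler_normB (phi a) (phi b); have := phiB a; have := phiB b.
  have : B *+ 2 <= B *+ 2 / d * `|a - b|.
    by rewrite mulrAC ler_pdivlMr// ler_wpM2l ?mulrn_wge0.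
  by rewrite mulr2n; lra.
Unshelve. all: by end_near. Qed.

(** Two distinct values would force, by the intermediate value theorem, the value 1/2 above the
    smaller one, which is not an integer. *)
Lemma continuous_int_cst {R : realType} (c : R -> R) :
  continuous c -> (forall t, exists m : int, c t = m%:~R) ->
  forall s t, c s = c t.
Proof.
move=> cc cint; suff lt_case s t : s <= t -> c s = c t.
  by move=> s t; have [/lt_case|/ltW/lt_case] := leP s t.
move=> st; apply/eqP/negPn/negP => neq.
have [ms cs] := cint s; have [mt ct] := cint t.
pose v := Num.min (c s) (c t) + 1 / 2.
have far : Num.min (c s) (c t) + 1 <= Num.max (c s) (c t).
  have [lt_st|lt_ts|//] := ltgtP (c s) (c t); last by move/eqP: neq.
  - by move: lt_st; rewrite cs ct ltr_int -lezD1 -(ler_int R) intrD.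
  - by move: lt_ts; rewrite cs ct ltr_int -lezD1 -(ler_int R) intrD.
have [||x _ cx] := @IVT R c s t v st.
- exact: continuous_subspaceT.
- by rewrite /v; apply/andP; split; lra.
have [mx] := cint x; rewrite cx /v.
have [m ->] : exists m : int, Num.min (c s) (c t) = m%:~R.
  by rewrite /Num.min; case: ifP => _; [exists ms|exists mt].
move=> mE.
have : (m%:~R < mx%:~R :> R) /\ (mx%:~R < (m + 1)%:~R :> R).
  by rewrite intrD -mE; split; lra.
by rewrite !ltr_int ltzD1 => -[/lt_le_trans h /h]; rewrite ltxx.
Qed.

(** * Lifts of circle maps *)

Section circle_lifts.
Context {R : realType}.
Implicit Types (T S : circle R -> circle R) (F : R -> R).

Lemma circle_projP (a b : R) :
  circle_proj a = circle_proj b <-> exists m : int, a = b + m%:~R.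
Proof.
have -> : circle_proj a = circle_proj b <-> a - b \in int_subgroup R.
  rewrite (Quotient.idealrBE (int_subgroup R)).
  by split=> [h|/eqP h]; [apply/eqP; exact: h|exact: h].
split=> [/intrP[m abm]|[m ->]]; first by exists m; rewrite -abm; ring.
by rewrite addrAC subrr add0r; exact: intr_int.
Qed.

Lemma circle_projD_int (t : R) (m : int) :
  circle_proj (t + m%:~R) = circle_proj t.
Proof. by apply/circle_projP; exists m. Qed.

Lemma circle_proj_surj (x : circle R) : exists t, circle_proj t = x.
Proof. by exists (repr x); exact: reprK. Qed.

Lemma lift_iter T F n t : is_lift T F ->
  circle_proj (iter n F t) = iter n T (circle_proj t).
Proof. by move=> [_ liftF]; elim: n => //= n <-. Qed.

(** The difference of the lifts is continuous and integer-valued, hence constant. *)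
Lemma lift_unique T F G : is_lift T F -> is_lift T G ->
  exists m : int, forall t, G t = F t + m%:~R.
Proof.
move=> [cF liftF] [cG liftG].
have GF t : exists m : int, G t - F t = m%:~R.
  have /circle_projP[m ->] : circle_proj (G t) = circle_proj (F t).
    by rewrite liftG liftF.
  by exists m; rewrite addrAC subrr add0r.
have [m m0] := GF 0; exists m => t.
have cGF : continuous (fun t => G t - F t).
  by move=> s; apply: cvgB; [exact: cG|exact: cF].
by have := continuous_int_cst _ cGF GF t 0; rewrite m0; lra.
Qed.

(** The increment over a period is a positive integer. Were it at least 2, [F] would take the value
    [F t + 1] strictly inside [(t, t + 1)], against injectivity of [T]. *)
Lemma lift_deg1 T F : injective T -> is_lift T F -> {homo F : s t / s < t} ->
  forall t, F (t + 1) = F t + 1.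
Proof.
move=> injT [cF liftF] incrF t.
have /circle_projP[m mE] : circle_proj (F (t + 1)) = circle_proj (F t).
  by rewrite !liftF (circle_projD_int t 1).
have lt_t1 : t < t + 1 by lra.
have := incrF _ _ lt_t1; rewrite mE ltrDl ltr0z => m0.
have [->//|m1] := eqVneq m 1; exfalso.
have m2 : 2 <= m%:~R :> R.
  have : (1 < m)%R by rewrite lt_neqAle eq_sym m1 -gtz0_ge1.
  by rewrite -lezD1 -(ler_int R).
have [||x] := @IVT R F t (t + 1) (F t + 1) (ltW lt_t1).
- exact: continuous_subspaceT.
- by rewrite mE; apply/andP; split; [rewrite ge_min|rewrite le_max]; lra.
rewrite in_itv /= => /andP[tx xt] Fx.
have : T (circle_proj x) = T (circle_proj t).
  by rewrite -!liftF Fx (circle_projD_int _ 1).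
move=> /injT /circle_projP[n xE].
have : (t < x) /\ (x < t + 1).
  split; rewrite lt_neqAle ?tx ?xt andbT; apply/eqP => e.
    by move: Fx; rewrite -e; lra.
  by move: Fx; rewrite e mE; lra.
rewrite xE ltrDl ltrD2l ltr0z ltrz1 => -[n0 n1].
by move: n1; rewrite -[1]add0r ltzD1 => /(lt_le_trans n0); rewrite ltxx.
Qed.

End circle_lifts.

(** * Stability of finite orbits under uniform perturbation *)

Lemma circle_dist_lt {R : realType} (x y : circle R) (d : R) :
  circle_dist x y < d ->
  exists a b, [/\ circle_proj a = x, circle_proj b = y & `|a - b| < d].
Proof.
move=> xyd; have [a ax] := circle_proj_surj x; have [b yb] := circle_proj_surj y.
have [|_ [a' /= a'x [b' /= b'y <-]] lt_d] := inf_lt _ xyd; last by exists a', b'.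
by exists `|a - b|; exists a => //; exists b.
Qed.

(** Induction on [n]: a new step adds the distance from [T] to [S], and [F] propagates the old error
    in a controlled way. [S] need not have a lift, so its orbit is followed through representatives
    chosen point by point. *)
Lemma iter_perturbation {R : realType} (T : circle R -> circle R) (F : R -> R) :
  is_lift T F -> (forall t, F (t + 1) = F t + 1) ->
  forall n (eta : R), 0 < eta -> exists2 d : R, 0 < d &
    forall S : circle R -> circle R,
      (forall x, circle_dist (T x) (S x) <= d) ->
      forall t, exists2 a, circle_proj a = iter n S (circle_proj t) &
        `|a - iter n F t| < eta.
Proof.
move=> [cF liftF] deg1.
(* [F] minus the identity is periodic, so it has an additive modulus. *)
have per t : F (t + 1) - (t + 1) = F t - t by rewrite deg1; ring.
have cont : continuous (fun t => F t - t).
  by move=> t; apply: cvgB; [exact: cF|exact: cvg_id].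
elim=> [|n IHn] eta eta0.
  by exists 1 => // S _ t; exists t => //=; rewrite subrr normr0.
have eta3 : 0 < eta / 3 by lra.
have [C C0 FC] := periodic_modulus _ per cont _ eta3.
have C3 : 0 < 3 * (C + 1) by lra.
have [d d0 dP] := IHn (eta / (3 * (C + 1))) (divr_gt0 eta0 C3).
(* [eta / 6] rather than [eta / 3], since [circle_dist_lt] asks for a strict bound. *)
exists (Num.min d (eta / 6)) => [|S TS t]; first by rewrite lt_min d0; lra.
have [|a aS a_near] := dP S _ t.
  by move=> x; have := TS x; rewrite le_min => /andP[].
have [|a' [b' [a'T b'S ab']]] := @circle_dist_lt R (T (circle_proj a)) (S (circle_proj a)) (eta / 3).
  by have := TS (circle_proj a); rewrite le_min => /andP[_ ?]; lra.
have /circle_projP[m mE] : circle_proj (F a) = circle_proj a' by rewrite liftF.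
exists (b' + m%:~R); first by rewrite circle_projD_int b'S /= aS.
have Fa : `|F a - F (iter n F t)| <= eta / 3 + eta / 3.
  have := FC a (iter n F t).
  have : (C + 1) * `|a - iter n F t| <= eta / 3.
    rewrite -ler_pdivlMl; last lra.
    by apply: le_trans (ltW a_near) _; rewrite invfM; lra.
  have := ler_normD (F a - a - (F (iter n F t) - iter n F t)) (a - iter n F t).
  have -> : F a - a - (F (iter n F t) - iter n F t) + (a - iter n F t) =
    F a - F (iter n F t) by ring.
  lra.
have := ler_normD (b' - a') (F a - F (iter n F t)).
have -> : b' - a' + (F a - F (iter n F t)) = b' + m%:~R - F (iter n F t).
  by rewrite mE; ring.
by rewrite (distrC b' a') /=; lra.
Qed.

Section circle_functions.
Context {R : realType} (f : circle R -> R).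
Hypothesis cf : continuous f.

Lemma continuous_comp_proj : continuous (f \o circle_proj).
Proof. exact/(quotient_continuous f). Qed.

Lemma comp_proj_periodic (t : R) : (f \o circle_proj) (t + 1) = (f \o circle_proj) t.
Proof. by rewrite /= (circle_projD_int t 1). Qed.

Lemma circle_continuous_bounded : exists2 B : R, 0 <= B & forall x, `|f x| <= B.
Proof.
have [B B0 fB] := periodic_bounded _ comp_proj_periodic continuous_comp_proj.
by exists B => // x; have [t <-] := circle_proj_surj x; exact: fB.
Qed.

Lemma circle_continuous_measurable : measurable_fun setT f.
Proof.
apply: (measurability _ (RGenOInfty.measurableE R)) => //.
move=> _ [_ [a ->] <-]; rewrite setTI; apply: sub_sigma_algebra.
by move/continuousP : cf; apply; exact: interval_open.
Qed.

(** Only finitely many times are involved, so the minimum of their thresholds works. *)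
Lemma observable_perturbation (T : circle R -> circle R) (F : R -> R) (s : seq nat)
    (eps : R) :
  is_lift T F -> (forall t, F (t + 1) = F t + 1) -> 0 < eps ->
  exists2 d : R, 0 < d & forall S : circle R -> circle R,
    (forall x, circle_dist (T x) (S x) <= d) ->
    forall k x, k \in s -> `|f (iter k S x) - f (iter k T x)| <= eps.
Proof.
move=> liftF deg1 eps0.
have eps2 : 0 < eps / 2 by lra.
have [C C0 fC] := periodic_modulus _ comp_proj_periodic continuous_comp_proj _ eps2.
have C1 : 0 < 2 * (C + 1) by lra.
elim: s => [|n s [d d0 dP]]; first by exists 1.
have [e e0 eP] := iter_perturbation T F liftF deg1 n _ (divr_gt0 eps0 C1).
exists (Num.min d e) => [|S TS k x]; first by rewrite lt_min d0.
rewrite in_cons => /predU1P[->|ks]; last first.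
  by apply: dP ks => y; have := TS y; rewrite le_min => /andP[].
have [t <-] := circle_proj_surj x.
have [|a <- a_near] := eP S _ t.
  by move=> y; have := TS y; rewrite le_min => /andP[].
rewrite -(lift_iter _ _ _ _ liftF).
apply: le_trans (fC _ _) _.
have : (C + 1) * `|a - iter n F t| <= eps / 2.
  rewrite -ler_pdivlMl; last lra.
  by apply: le_trans (ltW a_near) _; rewrite invfM; lra.
have := normr_ge0 (a - iter n F t); lra.
Qed.

End circle_functions.

(** * Integrals against invariant probability measures *)

Section invariant_integrals.
Context {R : realType} (mu : probability (circle R) R).

Lemma bounded_Rintegrable (g : circle R -> R) (B : R) :
  measurable_fun setT g -> (forall x, `|g x| <= B) ->
  mu.-integrable setT (EFin \o g).
Proof.
move=> mg gB; apply: measurable_bounded_integrable => //.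
  exact: le_lt_trans (probability_le1 mu measurableT) (ltry 1).
exists B; split; first exact: num_real.
by move=> x Bx y _ /=; apply: le_trans (gB y) (ltW Bx).
Qed.

(** Change of variables: by invariance, the pushforward of [mu] by [S] agrees with [mu] on
    measurable sets. *)
Lemma invariant_Rintegral (S : circle R -> circle R) (g : circle R -> R) (B : R) :
  measurable_fun setT S -> invariant_measure mu S ->
  measurable_fun setT g -> (forall x, `|g x| <= B) ->
  \int[mu]_x g (S x) = \int[mu]_x g x.
Proof.
move=> mS invS mg gB; rewrite /Rintegral; congr fine.
transitivity (\int[pushforward mu S]_x (g x)%:E)%E.
  rewrite integral_pushforward//.
  - by apply/measurable_EFinP.
  - apply: (bounded_Rintegrable _ B) => //; exact: measurableT_comp.
by apply: eq_measure_integral => A mA _; exact: invS.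
Qed.

Lemma measurable_iter (S : circle R -> circle R) n :
  measurable_fun setT S -> measurable_fun setT (iter n S).
Proof.
by move=> mS; elim: n => [|n IHn]; [exact: measurable_id|exact: measurableT_comp].
Qed.

Lemma invariant_Rintegral_iter (S : circle R -> circle R) (g : circle R -> R)
    (B : R) n :
  measurable_fun setT S -> invariant_measure mu S ->
  measurable_fun setT g -> (forall x, `|g x| <= B) ->
  \int[mu]_x g (iter n S x) = \int[mu]_x g x.
Proof.
move=> mS invS mg gB; elim: n => // n <-.
under eq_Rintegral do rewrite iterSr.
apply: (invariant_Rintegral S (g \o iter n S) B) => // [|x]; last exact: gB.
by apply: measurableT_comp => //; exact: measurable_iter.
Qed.

Lemma invariant_Rintegral_sum (S : circle R -> circle R) (g : circle R -> R)
    (B : R) (s : seq nat) :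
  measurable_fun setT S -> invariant_measure mu S ->
  measurable_fun setT g -> (forall x, `|g x| <= B) ->
  mu.-integrable setT (EFin \o (fun x => \sum_(k <- s) g (iter k S x))) /\
  \int[mu]_x (\sum_(k <- s) g (iter k S x)) = (size s)%:R * \int[mu]_x g x.
Proof.
move=> mS invS mg gB.
have mgS n : measurable_fun setT (g \o iter n S).
  by apply: measurableT_comp => //; exact: measurable_iter.
have igS n : mu.-integrable setT (EFin \o (g \o iter n S)).
  by apply: (bounded_Rintegrable _ B) => // x; exact: gB.
elim: s => [|n s [int_s IHs]].
  under [X in EFin \o X]eq_fun do rewrite big_nil.
  under eq_Rintegral do rewrite big_nil.
  by rewrite mul0r Rintegral_cst// mul0r; split=> //; exact: finite_measure_integrable_cst.
have -> : (fun x => \sum_(k <- n :: s) g (iter k S x)) =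
    (g \o iter n S) \+ (fun x => \sum_(k <- s) g (iter k S x)).
  by apply/funext => x; rewrite big_cons.
split.
  exact: (integrableD _ (igS n) int_s).
rewrite RintegralD// IHs (invariant_Rintegral_iter _ _ B)//.
by rewrite /= -natr1; ring.
Qed.

(** By invariance the orbit sum integrates to [size s] times the integral of [g]; since [mu] has
    mass 1, pointwise bounds on the sum pass to the integral. *)
Lemma Rintegral_near_average (S : circle R -> circle R) (g : circle R -> R)
    (B : R) (s : seq nat) (c e : R) :
  measurable_fun setT S -> invariant_measure mu S ->
  measurable_fun setT g -> (forall x, `|g x| <= B) -> (0 < size s)%N ->
  (forall x, `|\sum_(k <- s) g (iter k S x) - (size s)%:R * c| <= (size s)%:R * e) ->
  `|\int[mu]_x g x - c| <= e.
Proof.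
move=> mS invS mg gB s0 near_c.
have s0' : 0 < (size s)%:R :> R by rewrite ltr0n.
have [int_s sumE] := invariant_Rintegral_sum S g B s mS invS mg gB.
have int_cst (r : R) : mu.-integrable setT (EFin \o (fun=> r)).
  exact: finite_measure_integrable_cst.
have cstE (r : R) : \int[mu]_x r = r.
  by rewrite Rintegral_cst// -[X in _ * fine X]/(mu setT) probability_setT mulr1.
have up : \int[mu]_x (\sum_(k <- s) g (iter k S x)) <=
    \int[mu]_x ((size s)%:R * c + (size s)%:R * e).
  by apply: le_Rintegral => // x _; have := near_c x; rewrite ler_norml; lra.
have lo : \int[mu]_x ((size s)%:R * c - (size s)%:R * e) <=
    \int[mu]_x (\sum_(k <- s) g (iter k S x)).
  by apply: le_Rintegral => // x _; have := near_c x; rewrite ler_norml; lra.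
move: up lo; rewrite !cstE sumE -mulrDr -mulrBr !ler_pM2l// ler_norml => ? ?.
by apply/andP; split; lra.
Qed.

End invariant_integrals.

(** * Convergence of the invariant measures *)

Theorem theorem33 (R : realType) (deltabar : R) (alpha : R)
    (T : R -> circle R -> circle R)
    (mu : R -> probability (circle R) R) :
  0 < deltabar ->
  diffeomorphism (T 0) ->
  orientation_preserving (T 0) ->
  rotation_number (T 0) alpha ->
  irrational alpha ->
  circle_BV (fun x => ln (circle_deriv (T 0) x)) ->
  (forall delta : R, 0 <= delta <= deltabar -> measurable_fun setT (T delta)) ->
  (forall delta : R, 0 <= delta <= deltabar ->
    (ereal_sup [set (circle_dist (T 0 x) (T delta x))%:E | x in setT]
       <= delta%:E)%E) ->
  (forall delta : R, 0 <= delta <= deltabar ->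
    invariant_measure (mu delta) (T delta)) ->
  forall f : circle R -> R, continuous f ->
    \int[mu delta]_x f x @[delta --> 0^'+] --> \int[mu 0]_x f x.
Proof.
move=> deltabar0 [_ [T' [_ TK _]]] [F0 liftF0 incrF0] [F liftF rotF] irr _.
move=> mT closeT invT f cf.
(* Orientation and rotation number may come with different lifts; as these differ by an integer, [F]
   is increasing too. *)
have [m FE] := lift_unique _ _ _ liftF0 liftF.
have incrF : {homo F : s t / s < t}.
  by move=> s t st; rewrite !FE ltrD2r; exact: incrF0.
have deg1 := lift_deg1 _ _ (can_inj TK) liftF incrF.
have [B _ fB] := circle_continuous_bounded f cf.
have mf := circle_continuous_measurable f cf.
apply/cvgrPdist_le => eps eps0.
have eps4 : 0 < eps / 4 by rewrite divr_gt0.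
have per := comp_proj_periodic f.
have [s s0 unif] := uniform_orbit_averages F alpha incrF deg1 rotF irr _ _ per
  (periodic_modulus _ per (continuous_comp_proj f cf)) eps4.
have [d d0 dP] := observable_perturbation f cf (T 0) F s (eps / 4) liftF deg1 eps4.
have sR0 : (size s)%:R != 0 :> R by rewrite pnatr_eq0 -lt0n.
(* This constant depends on [T 0] and [s], not on [delta]: a common reference for all the
   integrals. *)
pose c := (\sum_(k <- s) f (circle_proj (iter k F 0))) / (size s)%:R.
(* One [eps / 4] pays for replacing [T delta] by [T 0], the other for replacing the orbit of [t] by
   that of 0. *)
have near_c delta : 0 <= delta <= deltabar -> delta <= d ->
    `|\int[mu delta]_x f x - c| <= eps / 2.
  move=> delta_itv delta_d.
  apply: (Rintegral_near_average _ (T delta) f B s) => //.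
  - exact: mT.
  - exact: invT.
  move=> x; have [t tx] := circle_proj_surj x.
  have close y : circle_dist (T 0 y) (T delta y) <= d.
    apply: le_trans delta_d; rewrite -lee_fin; apply: le_trans (closeT _ delta_itv).
    by apply: ereal_sup_ubound; exists y.
  have h1 : `|\sum_(k <- s) f (iter k (T delta) x) - \sum_(k <- s) f (iter k (T 0) x)|
      <= (size s)%:R * (eps / 4).
    rewrite -sumrB; apply: le_trans (ler_norm_sum _ _ _) _.
    have -> : (size s)%:R * (eps / 4) = \sum_(k <- s) (eps / 4).
      by rewrite big_const_seq count_predT iter_addr_0 mulr_natl.
    by rewrite big_seq [leRHS]big_seq; apply: ler_sum => k ks; exact: dP.
  have h2 := unif t 0.
  have -> : (size s)%:R * c = \sum_(k <- s) (f \o circle_proj) (iter k F 0).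
    by rewrite /c mulrC divfK.
  have sE : \sum_(k <- s) f (iter k (T 0) x) =
      \sum_(k <- s) (f \o circle_proj) (iter k F t).
    by apply: eq_bigr => k _; rewrite /= (lift_iter _ _ _ _ liftF) tx.
  rewrite sE in h1.
  apply: le_trans (ler_distD (\sum_(k <- s) (f \o circle_proj) (iter k F t)) _ _) _.
  lra.
near=> delta.
(* The estimate also applies at [delta = 0], as [mu 0] is invariant under [T 0]. *)
have h0 : `|\int[mu 0]_x f x - c| <= eps / 2.
  by apply: near_c; [rewrite lexx ltW|exact: ltW].
have hdelta : `|\int[mu delta]_x f x - c| <= eps / 2.
  apply: near_c; first (apply/andP; split); apply: ltW.
  - by near: delta; exact: nbhs_right_gt.
  - by near: delta; exact: nbhs_right_lt.
  - by near: delta; exact: nbhs_right_lt.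
have := ler_distD c (\int[mu 0]_x f x) (\int[mu delta]_x f x).
by rewrite (distrC c); lra.
Unshelve. all: by end_near. Qed.
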